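(* Suppose that $\kappa$ is a measurable cardinal and let $\xi<\kappa$ be an ordinal. Then $$\mathfrak{b}_{\mathrm{Id}^{+\xi}}(\in^* )\leq \kappa^{+\xi+1},$$ and $$\mathfrak{d}_{\mathrm{Id}^{+\xi}}(\in^* )<2^\kappa\ \Rightarrow\ 2^\kappa\leq\kappa^{+\xi}.$$
   Context: $\mathrm{Id}^{+\xi}:\kappa\to\kappa$ is the function $\alpha\mapsto\alpha^{+\xi}$, the $\xi$-th cardinal past $\alpha$ (for $\xi=0$ the identity). Functions $h:\kappa\to\kappa$ used as parameters are assumed to take no finite values (values below $\omega$ are irrelevant, since everything is modulo bounded sets). For $h:\kappa\to\kappa$, an $h$-slalom is a function $\varphi$ whose domain is a subset of $\kappa$ with bounded complement, such that $\varphi(\alpha)\subseteq\kappa$ and $|\varphi(\alpha)|=|h(\alpha)|$ for all $\alpha\in\mathrm{dom}(\varphi)$. For $f:\kappa\to\kappa$, write $f\in^*\varphi$ if $\{\alpha\in\mathrm{dom}(\varphi): f(\alpha)\notin\varphi(\alpha)\}$ is bounded in $\kappa$. $\mathfrak{b}_h(\in^* )$ is the least cardinality of a family $\mathcal F\subseteq\kappa^\kappa$ such that for every $h$-slalom $\varphi$ there is $f\in\mathcal F$ with $\neg(f\in^*\varphi)$. $\mathfrak{d}_h(\in^* )$ is the least cardinality of a family $\mathcal A$ of $h$-slaloms such that for every $f\in\kappa^\kappa$ there is $\varphi\in\mathcal A$ with $f\in^*\varphi$. *)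

(* Defs.v *)
From HB Require Import structures.
From mathcomp Require Import all_boot all_order.
From mathcomp Require Import generic_quotient.
From mathcomp Require Import boolp classical_sets functions cardinality filter.

Set Implicit Arguments.
Unset Strict Implicit.
Unset Printing Implicit Defensive.

Import Order.TTheory.

Local Open Scope order_scope.
Local Open Scope quotient_scope.
Local Open Scope classical_set_scope.
Local Open Scope card_scope.

(* Ordinals: well-founded trees with small branching, up to equality of rank; *)
(* [Node f] stands for the least ordinal above all the ordinals [f i].        *)
Inductive tree : Type := Node (I : Type) (f : I -> tree).

Fixpoint tree_le (x y : tree) : Prop :=
  match x, y with
  | Node _ f, Node _ g => forall i, exists j, tree_le (f i) (g j)
  end.

HB.instance Definition _ := gen_eqMixin tree.
HB.instance Definition _ := gen_choiceMixin tree.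

Lemma tree_le_refl x : tree_le x x.
Proof. by elim: x => I f IH /= i; exists i; apply: IH. Qed.

Lemma tree_le_trans y x z : tree_le x y -> tree_le y z -> tree_le x z.
Proof.
elim: x y z => I f IH [J g] [K h] /= fg gh i.
by have [j fgj] := fg i; have [k ghk] := gh j; exists k; apply: IH ghk.
Qed.

Lemma tree_leVlt I (f : I -> tree) y :
  tree_le (Node f) y \/ exists i, tree_le y (f i).
Proof.
elim: y I f => J g IH I f; have [|/existsNP[i /forallNP fiN]] :=
  pselect (forall i, exists j, tree_le (f i) (g j)); first by left.
right; exists i; case: (f i) fiN => K h hN j.
by have [/hN//|] := IH j K h.
Qed.

Lemma tree_le_Node I (f : I -> tree) i : tree_le (f i) (Node f).
Proof.
move: {2}(f i) (erefl (f i)) => x; elim: x I f i => J g IH I f i fi.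
by rewrite fi /= => j; exists i; rewrite fi; apply: IH.
Qed.

Lemma tree_le_total x y : tree_le x y \/ tree_le y x.
Proof.
case: x => I f; have [|[i yfi]] := tree_leVlt f y; first by left.
by right; apply: tree_le_trans yfi (tree_le_Node f i).
Qed.

Definition tree_equiv (x y : tree) : bool := `[< tree_le x y /\ tree_le y x >].

Lemma tree_equiv_refl : reflexive tree_equiv.
Proof. by move=> x; apply/asboolP; split; apply: tree_le_refl. Qed.

Lemma tree_equiv_sym : symmetric tree_equiv.
Proof. by move=> x y; apply/asboolP/asboolP => -[]. Qed.

Lemma tree_equiv_trans : transitive tree_equiv.
Proof.
move=> y x z /asboolP[xy yx] /asboolP[yz zy].
by apply/asboolP; split; [apply: tree_le_trans yz|apply: tree_le_trans yx].
Qed.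

Canonical tree_equiv_equiv :=
  EquivRel tree_equiv tree_equiv_refl tree_equiv_sym tree_equiv_trans.

Definition Ord := {eq_quot tree_equiv}.

HB.instance Definition _ := Choice.on Ord.

Definition ord_le (a b : Ord) : bool := `[< tree_le (repr a) (repr b) >].

Lemma ord_le_refl : reflexive ord_le.
Proof. by move=> a; apply/asboolP/tree_le_refl. Qed.

Lemma ord_le_anti : antisymmetric ord_le.
Proof.
move=> a b /andP[/asboolP ab /asboolP ba].
by rewrite -[a]reprK -[b]reprK; apply/eqmodP/asboolP.
Qed.

Lemma ord_le_trans : transitive ord_le.
Proof.
by move=> b a c /asboolP ab /asboolP bc; apply/asboolP/(tree_le_trans ab).
Qed.

Lemma ord_le_total : total ord_le.
Proof.
move=> a b; apply/orP.
by have [?|?] := tree_le_total (repr a) (repr b); [left|right]; apply/asboolP.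
Qed.

Fact ord_display : Order.disp_t. Proof. exact: Order.Disp tt tt. Qed.

HB.instance Definition _ :=
  Order.Le_isPOrder.Build ord_display Ord ord_le_refl ord_le_anti ord_le_trans.
HB.instance Definition _ :=
  Order.POrder_isTotal.Build ord_display Ord ord_le_total.

Lemma ord_wf : well_founded (fun a b : Ord => a < b).
Proof.
suff H x (a : Ord) : tree_le (repr a) x -> Acc (fun a b : Ord => a < b) a.
  by move=> a; apply: H (tree_le_refl _).
elim: x a => I f IH a aI; constructor => b; rewrite ltNge => /negP abN.
have [ab|[i bi]] := tree_leVlt f (repr b); last exact: IH bi.
by case: abN; apply/asboolP; apply: tree_le_trans ab.
Qed.

Definition zero : Ord := \pi_Ord (Node (fun v : void => match v with end)).

(* The default value [zero] is only used when P is empty. *)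
Definition least (P : set Ord) : Ord := xget zero (P `&` lbound P).

Lemma leastP (P : set Ord) : P !=set0 -> (P `&` lbound P) (least P).
Proof.
move=> P0; apply: xgetPex; case: P0 => a; elim/(well_founded_ind ord_wf): a.
move=> a IH Pa; have [ble|/existsNP[b /not_implyP[Pb /negP]]] :=
  pselect (forall b, P b -> a <= b); first by exists a.
by rewrite -ltNge => /IH; apply.
Qed.

Definition succ (a : Ord) : Ord := least [set b | a < b].

Definition below (a : Ord) : set Ord := [set b | b < a].

(* |A|, as an initial ordinal. A must be equipotent to a type in the universe *)
(* of branching types of [tree], as are all sets considered below: their      *)
(* elements are built from initial segments of Ord.                                *)
Definition card (T : Type) (A : set T) : Ord := least [set a | below a #= A].

Definition is_cardinal (a : Ord) : Prop := card (below a) = a.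

(* [plus a xi] is a^{+xi}, the xi-th cardinal past the ordinal a:             *)
(* a^{+0} = a, and if 0 < xi then a^{+xi} is the least cardinal above all the *)
(* a^{+eta} with eta < xi; see plusE.                                         *)
Definition plus (a : Ord) : Ord -> Ord :=
  Fix ord_wf (fun=> Ord) (fun xi rec =>
    if xi == zero then a else
    least [set c | is_cardinal c /\ forall eta (lt : eta < xi), rec eta lt < c]).

Lemma plusE (a xi : Ord) : plus a xi =
  if xi == zero then a else
  least [set c | is_cardinal c /\ forall eta, eta < xi -> plus a eta < c].
Proof.
rewrite {1}/plus Fix_eq // => x f g fg.
suff -> : f = g by [].
by apply: functional_extensionality_dep => y; apply: funext => lt; apply: fg.
Qed.

Section Kappa.
Variable kappa : Ord.

Definition bounded (B : set (below kappa)) : Prop :=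
  exists b : below kappa, forall a, B a -> val a <= val b.

Definition measurable_cardinal : Prop :=
  [/\ is_cardinal kappa,
      ~ countable (below kappa) &
      exists U : set_system (below kappa),
        [/\ UltraFilter U,
            forall a : below kappa, ~ U [set a] &
            forall S : set (set (below kappa)),
              S `<=` U -> card S < kappa -> U (\bigcap_(A in S) A)]].

Definition two_pow : Ord := card [set: set (below kappa)].

(* Partial functions from kappa to the subsets of kappa. Only the values of h *)
(* up to equipotence matter, and they are not required to lie below kappa, so *)
(* that Id^{+xi} can be defined before it is known to map kappa to kappa.     *)
Definition is_slalom (h : below kappa -> Ord)
    (phi : below kappa -> option (set (below kappa))) : Prop :=
  bounded [set a | phi a = None] /\
  forall a s, phi a = Some s -> s #= below (h a).

Definition in_star (f : below kappa -> below kappa)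
    (phi : below kappa -> option (set (below kappa))) : Prop :=
  bounded [set a | exists2 s, phi a = Some s & ~ s (f a)].

Definition b_in_star (h : below kappa -> Ord) : Ord :=
  least [set card F | F in [set F : set (below kappa -> below kappa) |
    forall phi, is_slalom h phi -> exists2 f, F f & ~ in_star f phi]].

Definition d_in_star (h : below kappa -> Ord) : Ord :=
  least [set card A |
         A in [set A : set (below kappa -> option (set (below kappa))) |
    A `<=` is_slalom h /\ forall f, exists2 phi, A phi & in_star f phi]].

Definition Id_plus (xi : Ord) (a : below kappa) : Ord := plus (val a) xi.

End Kappa.

Arguments Id_plus kappa xi a : clear implicits.

(* Main.v *)
From mathcomp Require Import all_boot all_order.
From mathcomp Require Import generic_quotient.
From mathcomp Require Import boolp classical_sets functions cardinality filter.
From mathcomp Require wochoice.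
Require Import Defs.
Import Order.TTheory.
Local Open Scope order_scope.
Local Open Scope quotient_scope.
Local Open Scope classical_set_scope.
Local Open Scope card_scope.

Set Implicit Arguments.
Unset Strict Implicit.
Unset Printing Implicit Defensive.

(** The proof counts functions modulo a normal ultrafilter [D] on [kappa],
    without forming the ultrapower. Call a set of functions on [kappa]
    separated if its elements are pairwise different modulo [D].

    - A single Id^{+xi}-slalom catches few functions ([caught_card]): a
      separated set of functions all caught by the same slalom has at most
      kappa^{+xi} elements. Enumerating the values of the slalom turns the
      caught functions into functions lying [D]-almost everywhere below
      [a |-> a^{+xi}], so it suffices to bound a separated set of such functions
      ([slice_card]). This goes by induction on [xi]. Normality settles xi = 0,
      since regressive functions are constant modulo [D]. For xi > 0, the order
      modulo [D] is a well-order all of whose proper initial segments inject, by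
      induction and completeness, below some kappa^{+zeta} with zeta < xi; and a
      well-order whose segments are all smaller than a cardinal has at most that
      many elements ([order_card]).

    - Bound on b. Take a transversal of the functions modulo [D]. If it has more
      than kappa^{+xi+1} elements, any subset of exactly this size is too large
      to be caught by one slalom. Otherwise the transversal itself is a witness:
      a slalom takes values of size below [kappa] ([plus_lt]), so some function
      avoids it everywhere, and so does its representative on a set in [D].

    - Bound on d. Since [kappa] is a strong limit, the initial parts of a subset
      X of [kappa] can be coded by ordinals below [kappa], which yields 2^kappa
      functions different modulo [D] ([separated_power]). If the slaloms of a
      family A catch all of them, then 2^kappa <= |A| * kappa^{+xi}, which by
      Hessenberg's theorem ([card_square]) is the maximum of the two factors.

    The ultrafilter [D] is the image of the given one under a non-constant
    function that is minimal modulo the ultrafilter ([normal_ultrafilter]).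
    As [card] is an ordinal chosen by minimality, sets must also be shown to be
    equipotent to some ordinal ([below_cardP]), which holds for the sets that
    inject into a type of the universe over which trees branch. *)

(** * Injections and cardinal comparison *)

Definition inj_on T U (A : set T) (f : T -> U) :=
  forall x y, A x -> A y -> f x = f y -> x = y.

Lemma set0Vex T (A : set T) : A = set0 \/ A !=set0.
Proof. by have [->|/set0P A0] := eqVneq A set0; [left|right]. Qed.

Lemma card_leI T U (A : set T) (B : set U) (f : T -> U) :
  (forall x, A x -> B (f x)) -> inj_on A f -> A #<= B.
Proof.
move=> fAB finj; have fi : {in A &, injective f}.
  by move=> x y /set_mem Ax /set_mem Ay; apply: finj.
rewrite -(card_le_eql (inj_card_eq fi)).
by apply: subset_card_le => _ [x Ax <-]; apply: fAB.
Qed.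

Lemma card_leE T U (A : set T) (B : set U) (u0 : U) : A #<= B ->
  exists f : T -> U, (forall x, A x -> B (f x)) /\ inj_on A f.
Proof.
move=> /card_leP[f]; pose g x :=
  if pselect (A x) is left Ax then val (f (SigSub (mem_set Ax))) else u0.
exists g; split=> [x Ax|x y Ax Ay]; rewrite /g.
  by case: pselect => // {}Ax; apply: set_mem; apply: valP.
case: pselect => // {}Ax; case: pselect => // {}Ay /val_inj.
by move=> /('inj_f (mem_set I) (mem_set I)) [].
Qed.

Lemma card_leEn T U (A : set T) (B : set U) : A !=set0 -> A #<= B ->
  exists f : T -> U, (forall x, A x -> B (f x)) /\ inj_on A f.
Proof.
move=> [a Aa] AB; have /card_leP[h] := AB.
exact: (card_leE (val (h (SigSub (mem_set Aa))))).
Qed.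

(** Stated for the subsets of a set, rather than of a type, so that it applies
    to the sets of ordinals [below a]. *)
Lemma cantor T (A : set T) : ~ ([set X | X `<=` A] #<= A).
Proof.
have [->|[a0 Aa0]] := set0Vex A.
  by move=> /card_le0P/seteqP[+ _] => /(_ set0); apply.
move=> /(card_leE a0)[f [fA finj]].
pose D := [set a | exists X, [/\ X `<=` A, f X = a & ~ X a]] `&` A.
have DA : D `<=` A by move=> a [].
have DfD : ~ D (f D).
  move=> [[X [XA fX] XfD] _]; suff : X (f D) by [].
  by rewrite (finj _ _ XA DA fX); split; [exists X|exact: fA].
by have : D (f D) by split; [exists D|exact: fA].
Qed.

(** * Small sets and upper bounds of ordinals *)

Definition branch (x : tree) : Type := match x with Node J _ => J end.

(** [Ord] lives one universe above the types over which trees branch. Small sets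
    are those of the size of such a type; naming the type through a tree pins its
    universe without any annotation. *)
Definition small T (A : set T) : Prop := exists x, A #<= [set: branch x].

Lemma small_le T U (A : set T) (B : set U) : A #<= B -> small B -> small A.
Proof. by move=> AB [x Bx]; exists x; apply: card_le_trans Bx. Qed.

(** The class of a tree, at the type that carries the order. *)
Definition tree_ord (x : tree) : Ord := \pi_Ord x.

Lemma tree_ordK a : tree_ord (repr a) = a.
Proof. exact: reprK. Qed.

Lemma tree_ord_leP x y : reflect (tree_le x y) (tree_ord x <= tree_ord y).
Proof.
have E z : tree_le (repr (tree_ord z)) z /\ tree_le z (repr (tree_ord z)).
  by have /eqmodP/asboolP[] : repr (tree_ord z) = z %[mod Ord] by apply: tree_ordK.
by apply: (iffP (asboolP _)) => xy;
  [apply: tree_le_trans (tree_le_trans xy (E y).1); apply: (E x).2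
  |apply: tree_le_trans (tree_le_trans xy (E y).2); apply: (E x).1].
Qed.

Lemma tree_le_NodeN I (f : I -> tree) i : ~ tree_le (Node f) (f i).
Proof.
move: {2}(f i) (erefl (f i)) => x; elim: x I f i => J g IH I f i fi.
move=> le; have := le; rewrite fi /= => /(_ i)[j]; rewrite fi.
exact: IH.
Qed.

Lemma lt_Node I (f : I -> tree) i : tree_ord (f i) < tree_ord (Node f).
Proof. by rewrite ltNge; apply/negP => /tree_ord_leP; apply: tree_le_NodeN. Qed.

Lemma lt_NodeP I (f : I -> tree) b :
  b < tree_ord (Node f) -> exists i, b <= tree_ord (f i).
Proof.
rewrite ltNge -[b]tree_ordK => /negP bN.
have [/tree_ord_leP//|[i bi]] := tree_leVlt f (repr b).
by exists i; apply/tree_ord_leP.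
Qed.

(** The tree whose immediate subtrees represent the values of [F] lies above all
    of them; smallness is what lets the values index the branches. *)
Lemma small_ub T (A : set T) (F : T -> Ord) :
  small A -> exists b : Ord, forall x, A x -> F x < b.
Proof.
case=> x; have [->|[a0 Aa0]] := set0Vex A; first by exists zero.
case: x => I f0 /=.
move=> /(card_leEn (ex_intro _ a0 Aa0))[f [_ finj]].
have /choice[g gP] : forall i, exists t : tree,
    forall y, A y -> f y = i -> F y = tree_ord t.
  move=> i; have [[y [Ay fy]]|no] := pselect (exists y, A y /\ f y = i).
    exists (repr (F y)) => z Az fz; rewrite tree_ordK; congr F.
    by apply: finj => //; rewrite fz.
  by exists (Node f0) => y Ay fy; case: no; exists y.
exists (tree_ord (Node g)) => y Ay.
by rewrite (gP (f y) y)//; apply: lt_Node.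
Qed.

(** Any ordinal below that of a tree is equal to, or below, that of an immediate
    subtree. So by induction the subtrees at all depths, which form a small
    type, represent all the smaller ordinals. *)
Lemma small_below a : small (below a).
Proof.
suff [x [s sP]] : exists x, exists s : branch x -> Ord,
    forall b, b < a -> exists i, s i = b.
  have /choice[f fP] : forall b, exists o : option (branch x), b < a ->
      exists2 i, o = Some i & s i = b.
    move=> b; have [ba|_] := boolP (b < a); last by exists None.
    by have [i si] := sP b ba; exists (Some i) => _; exists i.
  exists (Node (fun o : option (branch x) => Node (fun v : void => match v with end))).
  apply: (@card_leI _ _ _ _ f) => // b c /fP[i fi si] /fP[j fj sj].
  by rewrite fi fj -si -sj => -[->].
elim/(well_founded_ind ord_wf): a => a IH.
rewrite -[a]tree_ordK in IH *; case: (repr a) IH => I f IH.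
have /choice[p pP] : forall i : I, exists p : {x : tree & branch x -> Ord},
    forall b, b < tree_ord (f i) -> exists k, projT2 p k = b.
  move=> i; have [x [s sP]] := IH _ (lt_Node f i).
  by exists (existT _ x s).
pose J := (I + {i & branch (projT1 (p i))})%type.
exists (Node (fun _ : J => Node f)) => /=.
exists (fun j : J => match j with
  | inl i => tree_ord (f i) | inr (existT i k) => projT2 (p i) k end) => b.
move=> /lt_NodeP[i]; rewrite le_eqVlt => /orP[/eqP ->|]; first by exists (inl i).
by move=> /pP[k <-]; exists (inr (existT _ i k)).
Qed.

Lemma small_pow T (A : set T) : small A -> small [set X | X `<=` A].
Proof.
case=> x Ax; have [A0|A0] := set0Vex A.
  exists (Node (fun _ : unit => x)).
  apply: (@card_leI _ _ _ _ (fun=> tt)) => // X Y; rewrite /= A0 !subset0.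
  by move=> -> ->.
have [f [_ finj]] := card_leEn A0 Ax.
(* [set (branch x)] would not do: the constant [set] lands in a larger universe. *)
exists (Node (fun _ : branch x -> Prop => x)) => /=.
apply: (@card_leI _ _ _ _ (fun X => f @` X)) => // X Y XA YA XY.
have sub (X' Y' : set T) : X' `<=` A -> Y' `<=` A -> f @` X' = f @` Y' -> X' `<=` Y'.
  move=> XA' YA' e y X'y; have : (f @` X') (f y) by exists y.
  by rewrite e => -[z Y'z /finj <-//]; [apply: YA'|apply: XA'].
by apply/seteqP; split; apply: sub.
Qed.

Lemma card_leX T T' U U' (A : set T) (A' : set T') (B : set U) (B' : set U') :
  A #<= B -> A' #<= B' -> A `*` A' #<= B `*` B'.
Proof.
move=> AB AB'; have [->|[[a a'] [Aa Aa']]] := set0Vex (A `*` A').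
  by apply: card_ge0.
have [|f [fAB finj]] := card_leEn _ AB; first by exists a.
have [|f' [fAB' finj']] := card_leEn _ AB'; first by exists a'.
apply: (@card_leI _ _ _ _ (fun p => (f p.1, f' p.2))) => [p [/= p1 p2]|].
  by split; [apply: fAB|apply: fAB'].
by move=> [x x'] [y y'] [/= Ax Ax'] [/= Ay Ay'] [/finj-> // /finj'->].
Qed.

Lemma small_setX T U (A : set T) (B : set U) :
  small A -> small B -> small (A `*` B).
Proof.
case=> x Ax [y By]; exists (Node (fun p : branch x * branch y => x)) => /=.
by apply: card_le_trans (card_leX Ax By) (card_leT _).
Qed.

(** * Ranks, well-orders and cardinals *)

(** The Mostowski collapse of a well-founded transitive relation with small
    segments: the rank of [x] is the least ordinal above the ranks of its
    predecessors, and the ranks of the predecessors fill it. *)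
Lemma rank_exists T (A : set T) (R : T -> T -> Prop) :
  well_founded R ->
  (forall x y z, R x y -> R y z -> R x z) ->
  (forall x, A x -> small [set y | A y /\ R y x]) ->
  exists r : T -> Ord,
    (forall x y, A x -> A y -> R y x -> r y < r x) /\
    (forall x b, A x -> b < r x -> exists y, [/\ A y, R y x & r y = b]).
Proof.
move=> wfR Rtr Rsm.
pose body x (rec : forall y, R y x -> Ord) : Ord :=
  least [set a | forall y (Ryx : R y x), A y -> rec y Ryx < a].
pose r := Fix wfR (fun=> Ord) body.
have rE x : r x = least [set a | forall y, R y x -> A y -> r y < a].
  rewrite /r Fix_eq // => {}x f g fg.
  suff -> : f = g by [].
  by apply: functional_extensionality_dep => y; apply: funext => lt; apply: fg.
have rP x : A x -> (forall y, R y x -> A y -> r y < r x) /\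
    (forall a, (forall y, R y x -> A y -> r y < a) -> r x <= a).
  move=> Ax; rewrite [r x]rE; set P := [set a | _].
  have [|Pl lP] := @leastP P.
    by have [b bP] := small_ub r (Rsm x Ax); exists b => y Ryx Ay; apply: bP.
  by split=> //; apply: lP.
exists r; split=> [x y Ax Ay Ryx|x]; first exact: (rP x Ax).1.
elim/(well_founded_ind wfR): x => x IH b Ax brx.
have [y [Ay Ryx bry]] : exists y, [/\ A y, R y x & b <= r y].
  apply: contrapT => no; move: brx; rewrite ltNge => /negP; apply.
  apply: (rP x Ax).2 => y Ryx Ay; rewrite ltNge; apply/negP => bry.
  by apply: no; exists y.
move: bry; rewrite le_eqVlt => /orP[/eqP ->|]; first by exists y.
move=> /(IH y Ryx b Ay)[z [Az Rzy rz]].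
by exists z; split=> //; apply: Rtr Ryx.
Qed.

(** Well-order the set and collapse it: the ranks form an initial segment of the
    ordinals, which is [below a] for the least strict upper bound [a]. *)
Lemma below_cardP T (A : set T) : small A -> below (card A) #= A.
Proof.
move=> smA; suff : exists a, below a #= A.
  by case=> a aA; have [] := @leastP [set a | below a #= A] (ex_intro _ a aA).
have [R woR] := wochoice.well_ordering_principle {classic T}.
pose S (x y : T) : Prop := R x y /\ x <> y.
have min' (P : set T) : P !=set0 -> exists m, [/\ P m,
    forall y, P y -> R m y & forall m', P m' -> (forall y, P y -> R m' y) -> m = m'].
  case=> x Px; have [|m [[mP ml] mu]] := woR [pred x | `[< P x >]].
    by exists x; apply/asboolP.
  exists m; split; first exact/asboolP.
    by move=> y Py; apply: ml; apply/asboolP.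
  move=> m' Pm' m'l; apply: mu; split; first exact/asboolP.
  by move=> y /asboolP; apply: m'l.
have min P : P !=set0 -> exists2 m, P m & forall y, P y -> R m y.
  by move=> /min'[m [Pm ml _]]; exists m.
have refl x : R x x.
  by have [|m -> ] := min [set x]; [exists x|apply].
have anti x y : R x y -> R y x -> x = y.
  move=> xy yx; have [|m [_ _ mu]] := min' [set x; y]; first by exists x; left.
  have <- : m = x by apply: mu; [left|move=> z [->|->]].
  by apply: mu; [right|move=> z [->|->]].
have tot x y : R x y \/ R y x.
  have [|m [->|->] ml] := min [set x; y]; first by exists x; left.
  - by left; apply: ml; right.
  - by right; apply: ml; left.
have trans x y z : R x y -> R y z -> R x z.
  move=> xy yz; have [|m mP ml] := min [set x; y; z]; first by exists x; left; left.
  case: mP ml => [[->|->]|->] ml.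
  - by apply: ml; right.
  - by rewrite (anti x y xy (ml x _))//; left; left.
  - have zy := ml y (or_introl (or_intror erefl)).
    by rewrite -(anti y z yz zy).
have wfS : well_founded S.
  move=> x; apply: contrapT => nx.
  have [|m nm ml] := min [set x | ~ Acc S x]; first by exists x.
  apply: nm; constructor => y [ym ney]; apply: contrapT => /ml my.
  exact/ney/anti.
have [|x Ax|r [rS rP]] := @rank_exists T A S wfS.
- move=> x y z [xy nxy] [yz nyz]; split; first exact: trans yz.
  by move=> xz; apply: nxy; apply: anti => //; rewrite xz.
- by apply: small_le smA; apply: subset_card_le => y [].
have rinj : inj_on A r.
  move=> x y Ax Ay; apply: contraPP => nxy.
  have [xy|yx] := tot x y.
    by apply/eqP; rewrite lt_eqF// rS.
  by apply/eqP; rewrite gt_eqF// rS//; split=> // e; apply: nxy.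
have [b bP] := small_ub r smA.
have [|Pl lP] := @leastP [set b | forall x, A x -> r x < b]; first by exists b.
set a := least _ in Pl lP; exists a.
have -> : below a = r @` A.
  apply/seteqP; split=> [c ca|_ [x Ax <-]]; last exact: Pl.
  have [x [Ax crx]] : exists x, A x /\ c <= r x.
    apply: contrapT => no; move: ca; rewrite /below /= ltNge => /negP; apply.
    apply: lP => x Ax; rewrite ltNge; apply/negP => crx.
    by apply: no; exists x.
  move: crx; rewrite le_eqVlt => /orP[/eqP ->|]; first by exists x.
  by move=> /(rP x c Ax)[y [Ay _ <-]]; exists y.
apply: inj_card_eq => x y /set_mem Ax /set_mem Ay; exact: rinj.
Qed.

Lemma below_le a b : a <= b -> below a #<= below b.
Proof. by move=> ab; apply: subset_card_le => c /lt_le_trans; apply. Qed.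

Lemma card_ge T (A : set T) a : A #<= below a -> card A <= a.
Proof.
move=> Aa; have cA := below_cardP (small_le Aa (small_below a)).
rewrite leNgt; apply/negP => aA.
suff e : below a #= A.
  have [_ /(_ a e)] := @leastP [set a | below a #= A] (ex_intro _ a e).
  by rewrite leNgt -/(card A) aA.
apply/card_eqPle; split=> //; rewrite -(card_le_eqr cA).
exact/below_le/ltW.
Qed.

Lemma card_leVge T U (A : set T) (B : set U) : small A -> small B ->
  A #<= B \/ B #<= A.
Proof.
move=> /below_cardP cA /below_cardP cB.
rewrite -(card_le_eql cA) -(card_le_eqr cB) -(card_le_eql cB) -(card_le_eqr cA).
by have [/below_le|/ltW/below_le] := leP (card A) (card B); [left|right].
Qed.

Lemma eq_card T U (A : set T) (B : set U) : A #= B -> card A = card B.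
Proof.
move=> AB; rewrite /card; congr least; apply/seteqP.
by split=> a /=; rewrite (card_eqr AB).
Qed.

Lemma card_is_cardinal T (A : set T) : small A -> is_cardinal (card A).
Proof. by move=> sA; apply: eq_card; apply: below_cardP. Qed.

Lemma cardinal_le a b : is_cardinal a -> below a #<= below b -> a <= b.
Proof. by move=> ca /card_ge; rewrite [card _]ca. Qed.

Lemma cardinal_ltN a b : is_cardinal a -> b < a -> ~ (below a #<= below b).
Proof. by move=> ca ba /(cardinal_le ca); rewrite leNgt ba. Qed.

Lemma lt_card_pow a : a < card [set X | X `<=` below a].
Proof.
rewrite ltNge; apply/negP => /below_le.
rewrite (card_le_eql (below_cardP (small_pow (small_below a)))).
exact: cantor.
Qed.

(** Above a bound of the values of [F], the cardinal of its power set. *)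
Lemma cardinal_ub T (A : set T) (F : T -> Ord) : small A ->
  exists c : Ord, is_cardinal c /\ forall x, A x -> F x < c.
Proof.
move=> /(small_ub F)[b bP]; exists (card [set X | X `<=` below b]).
split; first exact/card_is_cardinal/small_pow/small_below.
by move=> x /bP/lt_trans; apply; apply: lt_card_pow.
Qed.

Lemma zero_le a : zero <= a.
Proof. by rewrite -[a]tree_ordK; apply/tree_ord_leP; case: (repr a) => I f []. Qed.

Lemma plus0 a : plus a zero = a.
Proof. by rewrite plusE eqxx. Qed.

(** The three clauses behind every later use of [plus]: for xi > 0, a^{+xi} is
    the least cardinal above all the earlier iterates. This treats the
    successor and limit steps at once. *)
Lemma plusP a xi : xi != zero ->
  [/\ is_cardinal (plus a xi), forall eta, eta < xi -> plus a eta < plus a xi &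
   forall c, is_cardinal c -> (forall eta, eta < xi -> plus a eta < c) ->
     plus a xi <= c].
Proof.
move=> /negPf xi0; rewrite [plus a xi]plusE xi0.
have [|[cl ll] lP] := @leastP [set c | is_cardinal c /\ forall eta, eta < xi -> plus a eta < c].
  by have [c cP] := cardinal_ub (plus a) (small_below xi); exists c.
by split=> // c cc cP; apply: lP.
Qed.

Lemma plus_cardinal a xi : is_cardinal a -> is_cardinal (plus a xi).
Proof.
move=> ca; have [->|/(plusP a)[]//] := eqVneq xi zero; by rewrite plus0.
Qed.

Lemma plus_lt_mono a eta xi : eta < xi -> plus a eta < plus a xi.
Proof.
move=> lt; have [|_ mono _] := @plusP a xi; last exact: mono.
by rewrite gt_eqF// (le_lt_trans (zero_le eta)).
Qed.

Lemma le_plus a xi : a <= plus a xi.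
Proof.
rewrite -[leLHS]plus0; have := zero_le xi; rewrite le_eqVlt => /orP[/eqP->//|].
by move=> /(plus_lt_mono a)/ltW.
Qed.

Lemma lt_succ a : a < succ a.
Proof.
have [|lt _ //] := @leastP [set b | a < b].
by exists (card [set X | X `<=` below a]); apply: lt_card_pow.
Qed.

(** If the rank of some [x] were at least [a], the ranks of the predecessors of
    [x] would fill [a], and [below a] would inject into the segment of [x]. So
    the rank function, injective by totality, takes its values below [a]. *)
Lemma order_card T (A : set T) (R : T -> T -> Prop) (a : Ord) :
  well_founded R ->
  (forall x y z, R x y -> R y z -> R x z) ->
  (forall x y, A x -> A y -> x = y \/ (R x y \/ R y x)) ->
  (forall x, A x -> small [set y | A y /\ R y x]) ->
  (forall x, A x -> ~ (below a #<= [set y | A y /\ R y x])) ->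
  A #<= below a.
Proof.
move=> wfR Rtr Rtot Rsm Rseg; have [r [rR rP]] := rank_exists wfR Rtr Rsm.
apply: (@card_leI _ _ _ _ r) => [x Ax|x y Ax Ay].
  rewrite /below /= ltNge; apply/negP => arx; apply: (Rseg x Ax).
  have /choice[s sP] : forall b, exists y, b < r x -> [/\ A y, R y x & r y = b].
    move=> b; have [/(rP x b Ax)[y yP]|_] := boolP (b < r x); first by exists y.
    by exists x.
  apply: (@card_leI _ _ _ _ s) => [b /lt_le_trans/(_ arx)/sP[]|b c] //.
  move=> /lt_le_trans/(_ arx)/sP[_ _ rb] /lt_le_trans/(_ arx)/sP[_ _ rc] sbc.
  by rewrite -rb -rc sbc.
case: (Rtot x y Ax Ay) => // -[xy|yx] e.
  by have := rR y x Ay Ax xy; rewrite e ltxx.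
by have := rR x y Ax Ay yx; rewrite e ltxx.
Qed.

(** * Squares of infinite ordinals *)

(** Hilbert's hotel: shift a sequence of distinct elements of [A]. *)
Lemma infinite_setU1_le T (A : set T) x : [set: nat] #<= A -> A `|` [set x] #<= A.
Proof.
move=> /card_leEn[|g [gA ginj]]; first by exists 0%N.
pose f y := if pselect (y = x) is left _ then g 0%N
  else if pselect (exists n, g n = y) is left h then g (projT1 (cid h)).+1 else y.
have fN y : y <> x -> ~ (exists n, g n = y) -> f y = y.
  by move=> yx ny; rewrite /f; case: pselect => //; case: pselect.
have fg n : g n <> x -> f (g n) = g n.+1.
  move=> gx; rewrite /f; case: pselect => // _; case: pselect => [h|[]]; last by exists n.
  by case: cid => m /= /ginj ->.
have fx : f x = g 0%N by rewrite /f; case: pselect.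
have [gI gT] : (forall m n, g m = g n -> m = n) /\ forall n, A (g n).
  by split=> [m n|n]; [apply: ginj|apply: gA].
have cases y : [\/ y = x, exists2 n, g n = y & y <> x | y <> x /\ ~ exists n, g n = y].
  have [->|yx] := pselect (y = x); first by constructor 1.
  have [[n gn]|gN] := pselect (exists n, g n = y); last by constructor 3.
  by constructor 2; exists n.
apply: (@card_leI _ _ _ _ f) => [y Ay|y z Ay Az].
  case: (cases y) => [->|[n <- nx]|[yx gN]]; first by rewrite fx.
    by rewrite fg.
  by rewrite fN//; case: Ay.
case: (cases y) => [->|[n <- nx]|[yx gN]]; case: (cases z) => [->|[m <- mx]|[zx gM]] //.
- by rewrite fx fg// => /gI.
- by rewrite fx (fN z)// => e; case: gM; exists 0%N.
- by rewrite fx fg// => /gI.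
- by rewrite !fg// => /gI[->].
- by rewrite fg// (fN z)// => e; case: gM; exists n.+1.
- by rewrite fx (fN y)// => e; case: gN; exists 0%N.
- by rewrite fg// (fN y)// => e; case: gN; exists m.+1.
- by rewrite !fN.
Qed.

(** Goedel's ordering of the pairs of ordinals, by maximum, then
    lexicographically: its segments lie in squares over smaller ordinals. *)
Definition godel (p q : Ord * Ord) : Prop :=
  let mp := Order.max p.1 p.2 in let mq := Order.max q.1 q.2 in
  mp < mq \/ mp = mq /\ (p.1 < q.1 \/ p.1 = q.1 /\ p.2 < q.2).

Lemma godel_wf : well_founded godel.
Proof.
suff H m : forall x y, Order.max x y = m -> Acc godel (x, y).
  by case=> x y; apply: H.
elim/(well_founded_ind ord_wf): m => m IHm x.
elim/(well_founded_ind ord_wf): x => x IHx y.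
elim/(well_founded_ind ord_wf): y => y IHy xym.
constructor=> -[x' y'] /= [|[]]; rewrite xym.
- by move=> lt; apply: IHm lt _ _ _.
- by move=> e [lt|[/= ex lt]]; [apply: IHx lt _ e|move: e; rewrite ex; apply: IHy].
Qed.

Lemma godel_trans p q r : godel p q -> godel q r -> godel p r.
Proof.
rewrite /godel; move=> [pq|[-> pq]] [qr|[<- qr]]; try by left.
  by left; apply: lt_trans qr.
right; split=> //; case: pq qr => [pq|[-> pq]] [qr|[<- qr]]; try by left.
  by left; apply: lt_trans qr.
by right; split=> //; apply: lt_trans qr.
Qed.

Lemma godel_total p q : p = q \/ (godel p q \/ godel q p).
Proof.
rewrite /godel; case: ltgtP => [m|m|<-]; [by right; left; left|by right; right; left|].
case: (ltgtP p.1 q.1) => [m|m|e1]; [by right; left; right; split=> //; left|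
  by right; right; right; split=> //; left|].
case: (ltgtP p.2 q.2) => [m|m|e2]; [by right; left; right; split=> //; right|
  by right; right; right; split=> //; right|].
by left; rewrite [p]surjective_pairing e1 e2 -surjective_pairing.
Qed.

(** Hessenberg's theorem. An ordinal equipotent to a smaller one inherits the
    claim from it. Otherwise the segment of a pair with maximum [m] lies in the
    square of the successor of [m], which has the size of [below m] by induction
    if [m] is infinite, and is finite otherwise; so [order_card] applies. *)
Theorem card_square a : [set: nat] #<= below a -> below a `*` below a #<= below a.
Proof.
elim/(well_founded_ind ord_wf): a => a IH inf.
have [[c ca ac]|init] := pselect (exists2 c, c < a & below a #<= below c).
  apply: card_le_trans (card_leX ac ac) (card_le_trans _ (below_le (ltW ca))).
  exact/IH/(card_le_trans inf).
have sa : small (below a `*` below a) by apply: small_setX; apply: small_below.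
apply: (order_card godel_wf godel_trans); first by move=> *; apply: godel_total.
  by move=> p _; apply: small_le sa; apply: subset_card_le => q [].
move=> [x y] [/= xa ya] aseg.
pose m := Order.max x y; pose L := below m `|` [set m].
have ma : m < a by rewrite /m maxEle; case: ifP.
have {aseg} aL : below a #<= L `*` L.
  apply: card_le_trans aseg _; apply: subset_card_le => -[u v] [/= _ uv].
  have [um vm] : u <= m /\ v <= m.
    apply/andP; rewrite -ge_max; case: uv => /= [/ltW//|[e _]].
    by rewrite /m -e.
  by split; rewrite /L /below /=; [move: um|move: vm];
    rewrite le_eqVlt => /orP[/eqP|]; by [left|right].
have [minf|mfin] := pselect ([set: nat] #<= below m).
  apply: init; exists m => //; apply: card_le_trans (IH m ma minf).
  by apply: card_le_trans aL _; apply: card_leX; apply: infinite_setU1_le.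
have Lfin : finite_set L.
  rewrite finite_setU; split; last exact: finite_set1.
  by apply: contrapT => /infiniteP.
by have /infiniteP := card_le_trans inf aL; apply; apply: finite_setX.
Qed.

(** * Complete ultrafilters *)

(** A nonprincipal kappa-complete ultrafilter in the form in which it is used:
    completeness is about families indexed by a type into which [kappa] does not
    inject, which covers at once the index types [nat] and [below c]. *)
Record complete_ultrafilter (kappa : Ord) (U : set (set (below kappa))) : Prop := {
  cu_sub : forall A B : set (below kappa), A `<=` B -> U A -> U B;
  cu_setC : forall A, ~ U A -> U (~` A);
  cu_ex : forall A, U A -> A !=set0;
  cu_setI : forall A B, U A -> U B -> U (A `&` B);
  cu_cap : forall I (A : I -> set (below kappa)), ~ (below kappa #<= [set: I]) ->
    (forall i, U (A i)) -> U [set a | forall i, A i a];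
  cu_set1 : forall a, ~ U [set a] }.

Lemma small_powT T : small [set: T] -> small [set: set T].
Proof. by move=> /small_pow; congr small; apply/seteqP; split. Qed.

Lemma card_eqW T U (A : set T) (B : set U) : A #= B -> A #<= B.
Proof. by move=> /card_eqPle[]. Qed.

Lemma small_belowT a : small [set: below a].
Proof. exact: small_le (card_eqW (card_setT _)) (small_below a). Qed.

Lemma below_valP k (a : below k) : val a < k.
Proof. exact: (set_mem (valP a)). Qed.

Definition to_below k c (ck : c < k) : below k := SigSub (mem_set ck : c \in below k).

Lemma measurable_ultrafilter kappa : measurable_cardinal kappa ->
  exists U, @complete_ultrafilter kappa U.
Proof.
case=> ck unc [U [UF Unp Ucap]]; exists U; split.
- by move=> A B AB; apply: filterS.
- by move=> A nA; have [] := in_ultra_setVsetC A UF.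
- by move=> A /filter_ex.
- by move=> A B; apply: filterI.
- move=> I A nI UA; have := Ucap [set A i | i in [set: I]].
  have -> : \bigcap_(B in [set A i | i in [set: I]]) B = [set a | forall i, A i a].
    apply/seteqP; split=> [a h i|a h _ [i _ <-]]; last exact: h.
    by apply: h; exists i.
  apply; first by move=> _ [i _ <-].
  have sm : small [set A i | i in [set: I]].
    apply: small_le (card_leT _) _.
    exact/small_powT/small_belowT.
  rewrite ltNge; apply/negP => /below_le.
  rewrite (card_le_eqr (below_cardP sm)) => le; apply: nI.
  exact: card_le_trans le (card_image_le _ _).
- exact: Unp.
Qed.

Section Ultrafilter.
Variables (kappa : Ord) (U : set (set (below kappa))).
Hypotheses (ck : is_cardinal kappa) (unc : ~ countable (below kappa)).
Hypothesis (cU : complete_ultrafilter U).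
Let K : Type := below kappa.

Lemma below_capP eta (A : Ord -> set K) : eta < kappa ->
  (forall zeta, zeta < eta -> U (A zeta)) ->
  U [set a | forall zeta, zeta < eta -> A zeta a].
Proof.
move=> ek UA.
have := @cu_cap _ _ cU (below eta) (fun z => A (val z)) _ (fun z => UA _ (below_valP z)).
move=> H; apply: (cu_sub cU) (H _) => [a Aa z ze|].
  exact: (Aa (to_below ze)).
by rewrite (card_le_eqr (card_setT _)); apply: cardinal_ltN.
Qed.

(** Otherwise fewer than [kappa] null fibres would cover a large set. *)
Lemma const_ae eta (F : K -> Ord) : eta < kappa ->
  U [set a | F a < eta] -> exists2 zeta, zeta < eta & U [set a | F a = zeta].
Proof.
move=> ek UF; apply: contrapT => no.
have /(@below_capP eta (fun z => ~` [set a | F a = z]) ek) :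
    forall z, z < eta -> U (~` [set a | F a = z]).
  by move=> z ze; apply: (cu_setC cU) => Uz; apply: no; exists z.
by move=> /(cu_setI cU UF)/(cu_ex cU)[a [/= Fa /(_ _ Fa)]].
Qed.

Lemma ne_ae (c : Ord) : U [set a | val a <> c].
Proof.
apply: (cu_setC cU) => Uc; have [a /= ac] := cu_ex cU Uc.
apply: (cu_set1 cU (a := a)); apply: cu_sub cU _ _ _ Uc => b /= bc.
by apply: val_inj; rewrite /= bc.
Qed.

(** An initial segment is a union of fewer than [kappa] points, each of them
    null. Hence bounded sets are null. *)
Lemma gt_ae (b : Ord) : b < kappa -> U [set a | b < val a].
Proof.
move=> bk; have := below_capP bk (fun z _ => ne_ae z).
move=> /(cu_setI cU (ne_ae b)); apply: (cu_sub cU) => a [/= ab aN].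
by rewrite ltNge le_eqVlt; apply/negP => /orP[/eqP //|/aN].
Qed.

Lemma not_bounded A : U A -> ~ bounded A.
Proof.
move=> UA [b Ab]; have [a [Aa /= ba]] := cu_ex cU (cu_setI cU UA (gt_ae (below_valP b))).
by have := Ab a Aa; rewrite leNgt ba.
Qed.

Lemma bounded_ae A : bounded A -> U (~` A).
Proof. by move=> bA; apply: (cu_setC cU) => /not_bounded. Qed.

(** Given subsets [f a] of [c] indexed by a < kappa, decide by [U] which z < c
    belong to almost all of them. By completeness almost all [f a] are equal to
    the set so defined, which is impossible for an injective [f]. *)
Lemma strong_limit c : c < kappa -> ~ (below kappa #<= [set X | X `<=` below c]).
Proof.
move=> clt; rewrite -(card_le_eql (card_setT _)) => /(card_leE set0)[f [fc finj]].
pose B z := U [set a | f a z].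
have H : U [set a | forall z, z < c -> (f a z <-> B z)].
  apply: below_capP => // z zc; have [Bz|nB] := pselect (B z).
    by apply: (cu_sub cU _ Bz) => a /= fz; split.
  by apply: (cu_sub cU) (cu_setC cU nB) => a /= fz; split.
have [a aB] := cu_ex cU H.
apply: (cu_set1 cU (a := a)); apply: (cu_sub cU) H => a' a'B /=.
apply: finj => //; apply/seteqP; split=> z fz.
  by have zc := fc _ I _ fz; apply/(aB z zc)/(a'B z zc).
by have zc := fc _ I _ fz; apply/(a'B z zc)/(aB z zc).
Qed.

(** By induction and completeness the iterates a^{+zeta}, zeta < eta, have a
    common bound c < kappa, and 2^c is a cardinal above c and below [kappa]. *)
Lemma plus_lt a eta : a < kappa -> eta < kappa -> plus a eta < kappa.
Proof.
move=> ak; elim/(well_founded_ind ord_wf): eta => eta IH ek.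
have [->|eta0] := eqVneq eta zero; first by rewrite plus0.
have /(@below_capP eta (fun z => [set c | plus a z < val c]) ek) :
    forall z, z < eta -> U [set c | plus a z < val c].
  by move=> z ze; apply: gt_ae; apply: IH => //; apply: lt_trans ek.
move=> /(cu_ex cU)[c /= cP].
have spow := small_pow (small_below (val c)).
have [_ _ /(_ (card [set X | X `<=` below (val c)]))] := plusP a eta0.
move=> /(_ (card_is_cardinal spow)) => H; apply: le_lt_trans (H _) _.
  by move=> z /cP /lt_trans; apply; apply: lt_card_pow.
rewrite ltNge; apply/negP => /below_le; rewrite (card_le_eqr (below_cardP spow)).
exact: strong_limit (below_valP c).
Qed.

Lemma all_ae A : (forall a, A a) -> U A.
Proof.
by move=> At; apply: contrapT => /(cu_setC cU)/(cu_ex cU)[a]; apply; apply: At.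
Qed.

Definition ult_lt (f g : K -> Ord) := U [set a | f a < g a].

(** A descending sequence modulo [U] would descend at every step at some single
    point, by countable completeness. *)
Lemma ult_lt_wf : well_founded ult_lt.
Proof.
move=> f; apply: contrapT => nf.
have /choice[next nextP] : forall f, exists g, ~ Acc ult_lt f -> ult_lt g f /\ ~ Acc ult_lt g.
  move=> {nf}g; have [//|ng] := pselect (Acc ult_lt g); first by exists g.
  have [h hP] : exists h, ult_lt h g /\ ~ Acc ult_lt h; last by exists h.
  apply: contrapT => no; apply: ng; constructor => h hg.
  by apply: contrapT => nh; apply: no; exists h.
pose s n := iter n next f.
have nacc n : ~ Acc ult_lt (s n) by elim: n => // n /nextP[].
have := @cu_cap _ _ cU nat (fun n => [set a | s n.+1 a < s n a]) _ (fun n => (nextP _ (nacc n)).1).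
move=> /(_ unc)/(cu_ex cU)[a /= desc].
suff H b n : s n a = b -> False by apply: (H _ 0%N erefl).
elim/(well_founded_ind ord_wf): b n => b IH n snb.
by apply: (IH (s n.+1 a) _ n.+1 erefl); rewrite -snb; apply: desc.
Qed.

End Ultrafilter.

(** Let [f] be minimal modulo [U] among the functions that are not almost
    everywhere constant; the identity is one. If [g] is regressive modulo the
    image of [U] under [f], then [g \o f] lies below [f] modulo [U], so it is
    almost everywhere constant by minimality. *)
Lemma normal_ultrafilter kappa : measurable_cardinal kappa ->
  exists U, @complete_ultrafilter kappa U /\
    forall g : below kappa -> Ord, U [set a | g a < val a] ->
      exists2 c, c < kappa & U [set a | g a = c].
Proof.
move=> mk; have [U cU] := measurable_ultrafilter mk; case: mk => ck unc _.
pose K : Type := below kappa.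
pose P (f : K -> K) := forall c, ~ U [set a | f a = c].
have [f Pf fmin] : exists2 f, P f & forall g, P g ->
    ~ ult_lt U (fun a => val (g a)) (fun a => val (f a)).
  suff H h : forall f : K -> K, h = (fun a => val (f a)) -> P f -> exists2 f, P f & forall g, P g ->
    ~ ult_lt U (fun a => val (g a)) (fun a => val (f a)).
    apply: (H _ id erefl) => c Uc; apply: (cu_set1 cU (a := c)).
    by apply: (cu_sub cU) Uc.
  elim/(well_founded_ind (ult_lt_wf unc cU)): h => h IH f hf Pf.
  have [|no] := pselect (exists2 g, P g & ult_lt U (fun a => val (g a)) h).
    by move=> [g Pg /IH]; apply.
  by exists f => // g Pg gf; apply: no; exists g => //; rewrite hf.
exists [set B | U (f @^-1` B)]; split; first split.
- by move=> A B AB; apply: (cu_sub cU) => a; apply: AB.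
- by move=> A /(cu_setC cU).
- by move=> A /(cu_ex cU)[a fa]; exists (f a).
- by move=> A B; apply: (cu_setI cU).
- by move=> I A nI UA; apply: (cu_cap cU nI UA).
- exact: Pf.
move=> g Ug; apply: contrapT => no.
pose g' (a : K) : K := insubd (f a) (g (f a)).
have Ug' : U [set a | g (f a) < val (f a) /\ val (g' a) = g (f a)].
  apply: (cu_sub cU) Ug => a /= ga; split=> //.
  rewrite /g' insubdK//; apply: mem_set; exact: lt_trans ga (below_valP _).
apply: (fmin g') => [c Uc|].
  apply: no; exists (val c); first exact: below_valP.
  by apply: (cu_sub cU) (cu_setI cU Ug' Uc) => a /= [[_ <-] ->].
by apply: (cu_sub cU) Ug' => a [ga /= ->].
Qed.

(** * Counting functions modulo a normal ultrafilter *)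

Section Normal.
Variables (kappa : Ord) (D : set (set (below kappa))).
Hypotheses (ck : is_cardinal kappa) (unc : ~ countable (below kappa)).
Hypothesis (cD : complete_ultrafilter D).
Hypothesis normal : forall g : below kappa -> Ord, D [set a | g a < val a] ->
      exists2 c, c < kappa & D [set a | g a = c].
Let K : Type := below kappa.

Definition separated (V : Type) (X : set (K -> V)) : Prop :=
  forall f g, X f -> X g -> D [set a | f a = g a] -> f = g.

Lemma ult_lt_trans f g h : ult_lt D f g -> ult_lt D g h -> ult_lt D f h.
Proof.
move=> fg gh; apply: (cu_sub cD) (cu_setI cD fg gh) => a [/=]; exact: lt_trans.
Qed.

Lemma ult_total (f g : K -> Ord) : [\/ D [set a | f a = g a], ult_lt D f g | ult_lt D g f].
Proof.
have [?|/(cu_setC cD) n1] := pselect (D [set a | f a = g a]); first by constructor 1.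
have [?|/(cu_setC cD) n2] := pselect (ult_lt D f g); first by constructor 2.
constructor 3; apply: (cu_sub cD) (cu_setI cD n1 n2) => a [/= /eqP ne /negP].
by rewrite -leNgt le_eqVlt eq_sym (negPf ne).
Qed.

(** In the induction step, let [g] be a member of [X]. As g(a) < a^{+eta}, the
    cardinal of g(a) is at most a^{+zeta} for some zeta < eta, and zeta does not
    depend on [a] for almost all [a]. Composing with injections of g(a) into
    a^{+zeta} then maps the segment of [g] into a set to which the induction
    hypothesis for zeta applies. *)
Lemma slice_card eta : eta < kappa -> forall X : set (K -> Ord),
  separated X -> (forall f, X f -> D [set a | f a < plus (val a) eta]) ->
  X #<= below (plus kappa eta).
Proof.
elim/(well_founded_ind ord_wf): eta => eta IH ek X sX Xeta.
have [e0|eta0] := eqVneq eta zero.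
  have /choice[c cP] : forall f, exists c, X f -> c < kappa /\ D [set a | f a = c].
    move=> f; have [Xf|nXf] := pselect (X f); last by exists zero.
    have [|c ltc Dc] := normal (g := f); last by exists c.
    by apply: (cu_sub cD) (Xeta f Xf) => a /=; rewrite e0 plus0.
  rewrite e0 plus0; apply: (@card_leI _ _ _ _ c) => [f /cP[]//|f g Xf Xg cfg].
  apply: sX => //; have [_ Df] := cP f Xf; have [_ Dg] := cP g Xg.
  by apply: (cu_sub cD) (cu_setI cD Df Dg) => a [/= -> ->].
have [pc plt _] := plusP kappa eta0.
have seg g : X g -> exists2 z, z < eta & [set f | X f /\ ult_lt D f g] #<= below (plus kappa z).
  move=> Xg.
  (* If every a^{+zeta} were below the cardinal of g(a), the minimality in the *)
  (* definition of a^{+eta} would give a^{+eta} <= g(a). *)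
  have /choice[z zP] : forall a : K, exists z, g a < plus (val a) eta ->
      z < eta /\ below (g a) #<= below (plus (val a) z).
    move=> a; have [ga|] := boolP (g a < plus (val a) eta); last by exists zero.
    have sg := small_below (g a).
    apply: contrapT => no.
    have [_ _ /(_ (card (below (g a))))] := plusP (val a) eta0.
    move=> /(_ (card_is_cardinal sg)) H.
    have : plus (val a) eta <= card (below (g a)).
      apply: H => z ze; rewrite ltNge; apply/negP => le; apply: no; exists z => _.
      by split=> //; rewrite -(card_le_eql (below_cardP sg)); apply: below_le.
    move=> /le_trans/(_ (card_ge (card_lexx _))).
    by rewrite leNgt ga.
  have Dz : D [set a | z a < eta].
    by apply: (cu_sub cD) (Xeta g Xg) => a /zP[].
  have [z0 z0e Dz0] := const_ae ck cD ek Dz.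
  have /choice[e eP] : forall a : K, exists e : Ord -> Ord,
      below (g a) #<= below (plus (val a) z0) ->
      (forall x, x < g a -> e x < plus (val a) z0) /\ inj_on (below (g a)) e.
    move=> a; have [/(card_leE zero)[e [e1 e2]]|nle] :=
      pselect (below (g a) #<= below (plus (val a) z0)); first by exists e.
    by exists id => /nle.
  have De : D [set a | below (g a) #<= below (plus (val a) z0)].
    by apply: (cu_sub cD) (cu_setI cD Dz0 (Xeta g Xg)) => a [/= <- /zP[]].
  exists z0 => //.
  pose Phi (f : K -> Ord) (a : K) := e a (f a).
  have Phi_inj f f' : X f -> ult_lt D f g -> X f' -> ult_lt D f' g ->
      D [set a | Phi f a = Phi f' a] -> f = f'.
    move=> Xf fg Xf' f'g Deq; apply: sX => //.
    apply: (cu_sub cD) (cu_setI cD (cu_setI cD fg f'g) (cu_setI cD Deq De)).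
    by move=> a [[/= fa f'a] [eq /eP[_ einj]]]; apply: einj.
  apply: (card_le_trans (B := Phi @` [set f | X f /\ ult_lt D f g])).
    apply: (@card_leI _ _ _ _ Phi) => [f Sf|f f' [Xf fg] [Xf' f'g] eq].
      by exists f.
    by apply: Phi_inj => //; apply: (all_ae cD) => a /=; rewrite eq.
  apply: IH => //; first exact: lt_trans ek.
    move=> _ _ [f [Xf fg] <-] [f' [Xf' f'g] <-] Deq.
    by rewrite (Phi_inj f f').
  move=> _ [f [Xf fg] <-].
  by apply: (cu_sub cD) (cu_setI cD fg De) => a [/= fa /eP[+ _]]; apply.
apply: (order_card (ult_lt_wf unc cD) ult_lt_trans).
- move=> f g Xf Xg; case: (ult_total f g) => [/(sX f g Xf Xg)|fg|gf].
  + by left.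
  + by right; left.
  + by right; right.
- by move=> g /seg[z _ /small_le]; apply; apply: small_below.
- move=> g /seg[z ze le] le'.
  exact: (cardinal_ltN pc (plt z ze)) (card_le_trans le' le).
Qed.

Variables (xi : Ord) (xk : xi < kappa).

(** Composing with enumerations of the values of the slalom makes the caught
    functions lie almost everywhere below [a |-> a^{+xi}], injectively modulo
    [D]. The exceptional sets are bounded, hence null. *)
Lemma caught_card phi (X : set (K -> K)) : is_slalom (Id_plus kappa xi) phi ->
  separated X -> (forall f, X f -> in_star f phi) -> X #<= below (plus kappa xi).
Proof.
move=> [bN phiS] sX Xphi.
have /choice[e eP] : forall a : K, exists e : K -> Ord, forall s, phi a = Some s ->
    (forall x, s x -> e x < plus (val a) xi) /\ inj_on s e.
  move=> a; case E: (phi a) => [s|]; last by exists (fun=> zero).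
  have /card_eqW/(card_leE zero)[e [e1 e2]] := phiS a s E.
  by exists e => _ [<-].
pose Phi (f : K -> K) (a : K) := e a (f a).
have Df f : X f -> D [set a | exists2 s, phi a = Some s & s (f a)].
  move=> /Xphi bf; have := cu_setI cD (bounded_ae ck cD bN) (bounded_ae ck cD bf).
  apply: (cu_sub cD) => a [/= aN aS]; case E: (phi a) aN aS => [s|] // _ aS.
  by exists s => //; apply: contrapT => ns; apply: aS; exists s.
have Phi_inj f f' : X f -> X f' -> D [set a | Phi f a = Phi f' a] -> f = f'.
  move=> Xf Xf' Deq; apply: sX => //.
  apply: (cu_sub cD) (cu_setI cD Deq (cu_setI cD (Df f Xf) (Df f' Xf'))).
  move=> a [/= eq [[s es sf] [s' es' sf']]].
  have [_ einj] := eP a s es; apply: einj => //.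
  by move: es'; rewrite es => -[->].
apply: (card_le_trans (B := Phi @` X)).
  apply: (@card_leI _ _ _ _ Phi) => [f Xf|f f' Xf Xf' eq]; first by exists f.
  by apply: Phi_inj => //; apply: (all_ae cD) => a /=; rewrite eq.
apply: slice_card => //.
  by move=> _ _ [f Xf <-] [f' Xf' <-] /(Phi_inj f f' Xf Xf') ->.
move=> _ [f Xf <-]; apply: (cu_sub cD) (Df f Xf) => a [s /eP[+ _] sf].
exact.
Qed.

(** * The bound on b *)

Lemma kappa_gt0 : zero < kappa.
Proof. exact: le_lt_trans (zero_le xi) xk. Qed.

Lemma transversal : exists2 T : set (K -> K), separated T &
  forall f, exists2 g, T g & D [set a | f a = g a].
Proof.
pose cl (f : K -> K) : set (K -> K) := [set g | D [set a | f a = g a]].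
have /choice[pick pickP] : forall P : set (K -> K), exists g, P !=set0 -> P g.
  by move=> P; have [->|[g Pg]] := set0Vex P; [exists id => -[]|exists g].
pose rep f := pick (cl f).
have repP f : D [set a | f a = rep f a].
  by apply: (pickP (cl f)); exists f; apply: (all_ae cD).
exists (range rep); last by move=> f; exists (rep f) => //; exists f.
move=> _ _ [f _ <-] [g _ <-] E; rewrite /rep; congr pick.
have fg : D [set a | f a = g a].
  apply: (cu_sub cD) (cu_setI cD E (cu_setI cD (repP f) (repP g))).
  by move=> a [/= e [-> ->]].
apply/seteqP; split=> h /= fh; apply: (cu_sub cD) (cu_setI cD fg fh) => a /=.
  by move=> [<-].
by move=> [->].
Qed.

Lemma small_functions : small [set: K -> K].
Proof.
have sK := small_belowT kappa.
have sKK : small [set: K * K] by rewrite -setXTT; apply: small_setX.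
apply: small_le (small_powT sKK).
apply: (@card_leI _ _ _ _ (fun f : K -> K => [set p | f p.1 = p.2])) => //.
move=> f g _ _ /seteqP[fg _]; apply: funext => a.
by rewrite (fg (a, f a)).
Qed.

Lemma small_partial_slaloms : small [set: K -> option (set K)].
Proof.
have sK := small_belowT kappa.
have sKK : small [set: K * K] by rewrite -setXTT; apply: small_setX.
have := small_setX (small_powT sKK) (small_powT sK); rewrite setXTT.
apply: small_le.
pose F (phi : K -> option (set K)) : set (K * K) * set K :=
  ([set p | exists2 s, phi p.1 = Some s & s p.2], [set a | phi a = None]).
apply: (@card_leI _ _ _ _ F) => // phi psi _ _ [/seteqP[e1 e1'] /seteqP[e2 e2']].
apply: funext => a; case E: (phi a) => [s|]; last by have /= := e2 a E.
case E' : (psi a) => [t|]; last by have := e2' a E'; rewrite /= E.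
congr Some; apply/seteqP; split=> x sx.
  by have [|t' /=] := e1 (a, x); [exists s|rewrite E' => -[->]].
by have [|t' /=] := e1' (a, x); [exists t|rewrite E => -[->]].
Qed.

(** The values of a slalom have size a^{+xi} < kappa, so none of them is all of
    [kappa]. *)
Lemma escape phi : is_slalom (Id_plus kappa xi) phi ->
  exists g : K -> K, forall a s, phi a = Some s -> ~ s (g a).
Proof.
move=> [_ phiS].
suff /choice[g gP] : forall a : K, exists x : K, forall s, phi a = Some s -> ~ s x.
  by exists g.
move=> a; case E: (phi a) => [s|]; last by exists a.
have [[x nsx]|no] := pselect (exists x, ~ s x); first by exists x => _ [<-].
have sT : s = setT by apply/seteqP; split=> // x _; apply: contrapT => ns; apply: no; exists x.
have := phiS a s E; rewrite sT => /card_eqW.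
rewrite (card_le_eql (card_setT _)) => /cardinal_ltN; case=> //.
exact: (plus_lt ck cD (below_valP a) xk).
Qed.

Lemma b_le : b_in_star (Id_plus kappa xi) <= plus kappa (succ xi).
Proof.
set lam := plus kappa (succ xi).
have cl : is_cardinal lam by apply: plus_cardinal.
suff [F FS Flam] : exists2 F : set (K -> K),
    (forall phi, is_slalom (Id_plus kappa xi) phi -> exists2 f, F f & ~ in_star f phi) &
    card F <= lam.
  apply: le_trans Flam.
  by have [|_] := @leastP [set card F | F in [set F : set (below kappa -> below kappa) |
    forall phi, is_slalom (Id_plus kappa xi) phi -> exists2 f, F f & ~ in_star f phi]];
    [exists (card F); exists F|apply; exists F].
have [T sT Tall] := transversal.
have smT : small T by apply: small_le (card_leT _) small_functions.
have [Tl|lT] := leP (card T) lam.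
  exists T => // phi phiS; have [g gP] := escape phiS.
  have [f Tf Df] := Tall g; exists f => // bf.
  have := cu_setI cD Df (cu_setI cD (bounded_ae ck cD phiS.1) (bounded_ae ck cD bf)).
  move=> /(cu_ex cD)[a [/= ga [aN aS]]].
  case E: (phi a) aN => [s|] // _; apply: aS; exists s => //.
  by rewrite -ga; apply: gP.
have /card_subP[F Flam FT] : below lam #<= T.
  by rewrite -(card_le_eqr (below_cardP smT)); apply/below_le/ltW.
exists F; last by apply: card_ge; apply: card_eqW.
move=> phi phiS; apply: contrapT => no.
have : F #<= below (plus kappa xi).
  apply: caught_card phiS _ _ => [f g Ff Fg|f Ff]; first by apply: sT; apply: FT.
  by apply: contrapT => nf; apply: no; exists f.
rewrite (card_le_eql Flam); apply: cardinal_ltN => //.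
by apply: plus_lt_mono; apply: lt_succ.
Qed.

(** * The bound on d *)

(** Send X to the function whose value at [a] codes the part of X below [a].
    Since [kappa] is a strong limit, these parts can be coded below [kappa]. The
    codes of X and Y differ beyond any point where X and Y differ; as tails are
    large, the two functions differ modulo [D]. *)
Lemma separated_power : exists code : set K -> K -> K, forall X Y,
  D [set a | code X a = code Y a] -> X = Y.
Proof.
have /choice[e eP] : forall a : K, exists e : set Ord -> K,
    inj_on [set X | X `<=` below (val a)] e.
  move=> a; have sp := small_pow (small_below (val a)).
  have [le|] := card_leVge sp (small_belowT kappa).
    by have [e [_ einj]] := card_leE a le; exists e.
  by rewrite (card_le_eql (card_setT _)) => /(strong_limit ck cD (below_valP a)).
exists (fun X a => e a [set val x | x in [set x | X x /\ val x < val a]]) => X Y DXY.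
have sub (X' Y' : set K) (a x : K) : val x < val a -> X' x ->
    [set val x | x in [set x | X' x /\ val x < val a]] =
    [set val x | x in [set x | Y' x /\ val x < val a]] -> Y' x.
  move=> xa X'x /seteqP[/(_ (val x)) + _].
  by case=> [|y [Y'y _] /val_inj <-//]; exists x.
have bel (X' : set K) (a : K) :
    [set val x | x in [set x | X' x /\ val x < val a]] `<=` below (val a).
  by move=> _ [y [_ ya] <-].
apply/seteqP; split=> x Xx.
  have [a [/= eXY xa]] := cu_ex cD (cu_setI cD DXY (gt_ae ck cD (below_valP x))).
  by apply: sub xa Xx (eP a _ _ _ _ eXY); apply: bel.
have [a [/= eXY xa]] := cu_ex cD (cu_setI cD DXY (gt_ae ck cD (below_valP x))).
by apply: sub xa Xx (eP a _ _ _ _ (esym eXY)); apply: bel.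
Qed.

(** Exchange [x] with 0, which belongs to every nonzero initial segment. *)
Lemma set_through (c : Ord) (x : K) : c < kappa ->
  exists s : set K, s #= below c /\ (zero < c -> s x).
Proof.
move=> ltc; pose o : K := to_below kappa_gt0.
pose t (y : K) : K := if y == x then o else if y == o then x else y.
have tK : involutive t.
  move=> y; rewrite /t; have [->|yx] := eqVneq y x.
    by rewrite eqxx; case: eqP.
  have [->|yo] := eqVneq y o; first by rewrite eqxx.
  by rewrite (negPf yx) (negPf yo).
exists (t @` [set y | val y < c]); split; last first.
  move=> c0; exists o => //; rewrite /t eqxx; case: eqP => //.
have tinj : {in [set y : K | val y < c] &, injective t} by move=> y z _ _; apply: inv_inj.
apply: card_eq_trans (inj_card_eq tinj) _.
have <- : [set val y | y in [set y : K | val y < c]] = below c.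
  apply/seteqP; split=> [_ [y yc <-]//|z zc].
  by exists (to_below (lt_trans zc ltc)).
by apply: card_esym; apply: inj_card_eq => y z _ _; apply: val_inj.
Qed.

(** The family of all slaloms catches everything, so the minimum defining d is
    attained. The only point where [f] may have to be missed is 0, for xi = 0. *)
Lemma slalom_exists (f : K -> K) : exists2 phi,
  is_slalom (Id_plus kappa xi) phi & in_star f phi.
Proof.
have /choice[s sP] : forall a : K, exists s : set K,
    s #= below (plus (val a) xi) /\ (zero < plus (val a) xi -> s (f a)).
  by move=> a; apply/set_through/(plus_lt ck cD (below_valP a) xk).
exists (fun a => Some (s a)).
  split; first by exists (to_below kappa_gt0).
  by move=> a _ [<-]; apply: (sP a).1.
exists (to_below kappa_gt0) => a [_ [<-] nsf] /=.
rewrite leNgt; apply/negP => a0; apply: nsf; apply: (sP a).2.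
exact: lt_le_trans a0 (le_plus _ _).
Qed.

(** Each X is determined by a slalom of the family catching its code, together
    with the position of the code among those assigned to this slalom. *)
Lemma two_pow_le : d_in_star (Id_plus kappa xi) < two_pow kappa ->
   two_pow kappa <= plus kappa xi.
Proof.
have [|[A [AS Acatch] cA] _] := @leastP [set card A |
         A in [set A : set (below kappa -> option (set (below kappa))) |
    A `<=` is_slalom (Id_plus kappa xi) /\ forall f, exists2 phi, A phi & in_star f phi]].
  pose A := is_slalom (Id_plus kappa xi); exists (card A); exists A => //.
  by split=> // f; have [phi ? ?] := slalom_exists f; exists phi.
rewrite /d_in_star -{}cA => Alt; rewrite leNgt; apply/negP => lamlt.
set lam := plus kappa xi in lamlt *.
have smA : small A by apply: small_le (card_leT _) small_partial_slaloms.
have smP : small [set: set K] by apply/small_powT/small_belowT.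
have [code codeP] := separated_power.
have /choice[phi phiP] : forall X : set K, exists phi, A phi /\ in_star (code X) phi.
  by move=> X; have [phi ? ?] := Acatch (code X); exists phi.
have /choice[e eP] : forall psi, exists e : (K -> K) -> Ord, A psi ->
    let Z := [set code X | X in [set X | phi X = psi]] in
    (forall f, Z f -> e f < lam) /\ inj_on Z e.
  move=> psi; have [Apsi|nA] := pselect (A psi); last by exists (fun=> zero).
  have le : [set code X | X in [set X | phi X = psi]] #<= below lam.
    apply: (caught_card (AS psi Apsi)).
      by move=> _ _ [X _ <-] [Y _ <-] /codeP ->.
    by move=> _ [X <- <-]; have [] := phiP X.
  by have [e [e1 e2]] := card_leE zero le; exists e.
have le1 : [set: set K] #<= A `*` below lam.
  apply: (@card_leI _ _ _ _ (fun X => (phi X, e (phi X) (code X)))) => [X _|X Y _ _ [pXY]].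
    have [AX _] := phiP X; split=> //=.
    by have [+ _] := eP _ AX; apply; exists X.
  have [AX _] := phiP X; have [_ einj] := eP _ AX.
  rewrite -pXY => /einj eXY.
  have e' : code X = code Y by apply: eXY; [exists X|exists Y].
  by apply: codeP; rewrite e'; apply: (all_ae cD).
pose mu := Order.max (card A) lam.
have muP : mu < two_pow kappa by rewrite /mu maxEle; case: ifP.
have inf : [set: nat] #<= below mu.
  apply: (card_le_trans (B := below kappa)).
    by apply/infiniteP => /finite_set_countable.
  by apply: below_le; apply: le_trans (le_plus kappa xi) _; rewrite /mu le_max lexx orbT.
have : below (two_pow kappa) #<= below mu.
  rewrite (card_le_eql (below_cardP smP)).
  apply: card_le_trans le1 (card_le_trans _ (card_square inf)).
  apply: card_leX; last by apply: below_le; rewrite /mu le_max lexx orbT.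
  by rewrite -(card_le_eql (below_cardP smA)); apply: below_le; rewrite /mu le_max lexx.
by apply: cardinal_ltN => //; apply: card_is_cardinal.
Qed.

End Normal.

Theorem mainTheorem2 (kappa xi : Ord) :
  measurable_cardinal kappa -> xi < kappa ->
  b_in_star (Id_plus kappa xi) <= plus kappa (succ xi) /\
  (d_in_star (Id_plus kappa xi) < two_pow kappa ->
   two_pow kappa <= plus kappa xi).
Proof.
move=> mk xk; have [D [cD normal]] := normal_ultrafilter mk.
case: mk => ck unc _.
by split; [exact: b_le cD normal xi xk|exact: two_pow_le cD normal xi xk].
Qed.
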